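(* Let $r\ge2$ be a fixed integer. For each integer $n\ge1$ let $\overline{X^{(r)}}=\frac1{rn}\sum_{k=1}^{rn}X_k^{(r)}$. Then for every $n\ge1$, $$\mathbb{E}\,\overline{X^{(r)}}=\frac{(r-1)(rn+1)}{2(r+1)}.$$ Moreover, for every function $\omega$ with $\omega(n)\to\infty$ as $n\to\infty$, $$\lim_{n\to\infty}\mathbb{P}\left(\left|\overline{X^{(r)}}-\frac{(r-1)rn}{2(r+1)}\right|\le\omega(n)\sqrt n\right)=1.$$
   Context: $[m]=\{1,2,\dots,m\}$. An $r$-matching on $[rn]$ is a partition of $[rn]$ into $n$ subsets of size $r$, called edges. There are $\frac{(rn)!}{(r!)^n n!}$ of them. For an $r$-matching $M$ on $[rn]$ and $k\in[rn]$, let $M_k$ be the set of all edges of $M$ having nonempty intersection with both $[k]$ and $[rn]\setminus[k]$, and let $x_k(M)=\sum_{e\in M_k}|e\cap[k]|$ (in particular $x_{rn}(M)=0$). Let $\mathbf{M}^{(r)}_n$ be an $r$-matching chosen uniformly at random from all $r$-matchings on $[rn]$, and let $X^{(r)}_k=x_k(\mathbf{M}^{(r)}_n)$ for $k\in[rn]$. *)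

(* Defs.v *)
From mathcomp Require Import all_boot all_order all_algebra.

Set Implicit Arguments.
Unset Strict Implicit.
Unset Printing Implicit Defensive.

Import Order.TTheory GRing.Theory Num.Theory.

(* The ground set [N] = {1, ..., N} is modelled by 'I_N, with the ordinal i
   standing for i + 1; hence [k] becomes the set of the ordinals i < k. *)

Section Matching.

Variables r n : nat.
Implicit Types (M : {set {set 'I_(r * n)}}) (k : nat).

Definition matchings : {set {set {set 'I_(r * n)}}} :=
  [set M | [&& partition M [set: 'I_(r * n)], #|M| == n
             & [forall e in M, #|e| == r]]].

Definition prefix_set k : {set 'I_(r * n)} := [set i : 'I_(r * n) | i < k].

Definition crossing_edges M k : {set {set 'I_(r * n)}} :=
  [set e in M | (e :&: prefix_set k != set0)
              & (e :&: ~: prefix_set k != set0)].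

Definition crossing_weight M k : nat :=
  \sum_(e in crossing_edges M k) #|e :&: prefix_set k|.

Definition mean_crossing_weight (R : realFieldType) M : R :=
  ((r * n)%:R^-1 *
     \sum_(1 <= k < (r * n).+1) (crossing_weight M k)%:R)%R.

End Matching.

Section UniformProbability.

Variables (R : realFieldType) (T : finType) (Omega : {set T}).

(* Both are meaningful only for nonempty Omega; they are 0 otherwise. *)

Definition finset_uniform_expectation (X : T -> R) : R :=
  (#|Omega|%:R^-1 * \sum_(t in Omega) X t)%R.

Definition finset_uniform_prob (A : pred T) : R :=
  (#|[set t in Omega | A t]|%:R / #|Omega|%:R)%R.

End UniformProbability.

(* Main.v *)
Require Import Defs.
From mathcomp Require Import all_boot all_order all_algebra.
From mathcomp Require Import zify ring lra.

(** Let Y_k be the number of edges of M contained in [k]. The sum of |e :&: [k]|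
    over all edges e is k, and the edges inside [k] account for r Y_k of it, so
    x_k(M) = k - r Y_k and the mean of the x_k is (rn + 1)/2 - (1/n) sum_k Y_k.
    A given r-set is an edge of M with probability n / C(rn, r), and the
    hockey-stick identity yields the expectation. If e and f are distinct edges
    of a random matching and k <= l, the events that e lies in [k] and that f
    lies in [l] are negatively correlated, as C(l - r, r) C(rn, r) <=
    C(l, r) C(rn - r, r); hence Cov(Y_k, Y_l) <= n. Therefore the variance of
    the mean of the x_k is at most r^2 n, and Chebyshev's inequality gives the
    concentration. *)

Set Implicit Arguments.
Unset Strict Implicit.
Unset Printing Implicit Defensive.

(** * Binomial coefficients *)

Lemma bin_subn_mul_le r l N :
  (l <= N)%N -> ('C(l - r, r) * 'C(N, r) <= 'C(l, r) * 'C(N - r, r))%N.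
Proof.
move=> leqlN.
have fact2_gt0 : (0 < r`! * r`!)%N by rewrite muln_gt0 !fact_gt0.
rewrite -(leq_pmul2r fact2_gt0) mulnACA [leqRHS]mulnACA !bin_ffact.
rewrite !ffact_prod -!big_split /=; apply: leq_prod => i _.
nia.
Qed.

Lemma sum_bin_hockey_stick r N : 0 < r ->
  \sum_(1 <= k < N.+1) 'C(k, r) = 'C(N.+1, r.+1).
Proof.
case: r => // r _; elim: N => [|N IHN]; first by rewrite big_geq // bin_small.
by rewrite big_nat_recr //= IHN [RHS]binS addnC.
Qed.

(** * Double counting over partitions into blocks of size [r] *)

Section UniformPartitions.

Variables (T : finType) (r : nat).
Hypothesis r_gt0 : (0 < r)%N.
Implicit Types (A B D e : {set T}) (P Q : {set {set T}}).

(** The ground set [D] is a parameter, so that removing a block leaves an object of the same kind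
    over the same type. *)
Definition uniform_partitions D : {set {set {set T}}} :=
  [set P | partition P D & [forall e in P, #|e| == r]].

Lemma uniform_partitionsP P D :
  reflect (partition P D /\ {in P, forall e, #|e| = r})
          (P \in uniform_partitions D).
Proof.
rewrite inE; apply: (iffP andP) => -[partP cardP]; split=> //.
  by move=> e eP; apply/eqP; move/forall_inP: cardP; apply.
by apply/forall_inP => e /cardP ->.
Qed.

Lemma card_block D P e : P \in uniform_partitions D -> e \in P -> #|e| = r.
Proof. by case/uniform_partitionsP=> _; apply. Qed.

Lemma block_sub D P e : P \in uniform_partitions D -> e \in P -> e \subset D.
Proof. by case/uniform_partitionsP=> partP _; apply: partitionS. Qed.

Lemma card_blocks D P n :
  P \in uniform_partitions D -> #|D| = (r * n)%N -> #|P| = n.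
Proof.
case/uniform_partitionsP=> partP cardP.
rewrite (card_uniform_partition cardP partP) mulnC => /eqP.
by rewrite eqn_pmul2l // => /eqP.
Qed.

Lemma uniform_partitionsU1 D P e : e \subset D -> #|e| = r ->
  e \notin P ->
  (e |: P \in uniform_partitions D) = (P \in uniform_partitions (D :\: e)).
Proof.
move=> eD er eP.
have e_neq0 : e != set0 by rewrite -card_gt0 er.
apply/uniform_partitionsP/uniform_partitionsP => -[partP cardP]; split.
- by rewrite -(setU1K eP); apply: partitionD1 => //; rewrite setU11.
- by move=> f fP; apply: cardP; rewrite setU1r.
- rewrite -(setID D e) (setIidPr eD).
  by apply: partitionU1 => //; rewrite -setI_eq0 setDE setICA setICr setI0.
- by move=> f /setU1P[->//|/cardP].
Qed.

Lemma sum_uniform_partitions_block D e (F : {set {set T}} -> nat) :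
  e \subset D -> #|e| = r ->
  \sum_(P in uniform_partitions D | e \in P) F P
    = \sum_(Q in uniform_partitions (D :\: e)) F (e |: Q).
Proof.
move=> eD er.
rewrite (reindex_onto (fun Q => e |: Q) (fun P => P :\ e)) /=; last first.
  by move=> P /andP[_ eP]; apply: setD1K.
apply: eq_bigl => Q; rewrite setU11 andbT.
(* If [e] already lies in [Q], both sides are false: deleting [e] from [e |: Q] does not return [Q],
   and the nonempty [e] is not a block of a partition of [D :\: e]. *)
have [eQ|eQ] := boolP (e \in Q); last first.
  by rewrite uniform_partitionsU1 // setU1K // eqxx andbT.
have -> : ((e |: Q) :\ e == Q) = false.
  by apply/eqP => /setP/(_ e); rewrite eQ setD11.
rewrite andbF; apply/esym/negP => /block_sub/(_ eQ) eDe.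
have := subset_trans eDe (subsetDr _ _); rewrite -disjoints_subset -setI_eq0.
by rewrite setIid -cards_eq0 er eqn0Ngt r_gt0.
Qed.

(** The count of blocks in [A] is a sum of indicators over the [r]-subsets [e] of [A]; the sums are
    exchanged and the block [e] is removed. *)
Lemma sum_blocks_exchange D A (F : {set {set T}} -> nat) : A \subset D ->
  \sum_(P in uniform_partitions D) #|P ::&: A| * F P
    = \sum_(e : {set T} | (e \subset A) && (#|e| == r))
        \sum_(Q in uniform_partitions (D :\: e)) F (e |: Q).
Proof.
move=> AD; transitivity (\sum_(P in uniform_partitions D)
    \sum_(e : {set T} | (e \subset A) && (#|e| == r)) (e \in P) * F P).
  apply: eq_bigr => P PD; rewrite -big_distrl /=; congr (_ * _).
  rewrite -big_mkcondr /= sum1dep_card; apply: eq_card => e; rewrite !inE.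
  have [eP|//] := boolP (e \in P); last by rewrite !andbF.
  by rewrite (card_block PD eP) eqxx !andbT.
rewrite exchange_big /=; apply: eq_bigr => e /andP[eA /eqP er].
rewrite -sum_uniform_partitions_block //; last exact: subset_trans AD.
by rewrite [RHS]big_mkcondr; apply: eq_bigr => P _; case: ifP; rewrite ?mul1n.
Qed.

Lemma card_draws_sum A c :
  \sum_(e : {set T} | (e \subset A) && (#|e| == r)) c = 'C(#|A|, r) * c.
Proof. by rewrite sum_nat_const -cards_draws cardsE. Qed.

Lemma card_blocks_sub_full D P n :
  #|D| = (r * n)%N -> P \in uniform_partitions D -> #|P ::&: D| = n.
Proof.
move=> cardD PD; rewrite -(card_blocks PD cardD); apply: eq_card => e.
rewrite inE; have [eP|//] := boolP (e \in P).
by rewrite (block_sub PD eP).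
Qed.

(** Induction on [n], counting pairs of a partition and one of its blocks in two ways. *)
Lemma card_uniform_partitions D n : #|D| = (r * n)%N ->
  #|uniform_partitions D| * (r`! ^ n * n`!) = (r * n)`!.
Proof.
elim: n D => [|n IHn] D cardD.
  move: cardD; rewrite muln0 => /eqP; rewrite cards_eq0 => /eqP ->.
  rewrite expn0 fact0 !muln1.
  rewrite -[RHS](cards1 (set0 : {set {set T}})); apply: eq_card => P.
  rewrite !inE partition_set0; have [->|//] := eqVneq P set0.
  by apply/forall_inP => e; rewrite inE.
have := sum_blocks_exchange (fun _ => 1) (subxx D).
under eq_bigr => P PD do rewrite (card_blocks_sub_full cardD PD) muln1.
rewrite sum_nat_const => sumE.
rewrite factS (mulnCA (r`! ^ n.+1)) mulnA sumE big_distrl /=.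
under eq_bigr => e /andP[eD /eqP er].
  rewrite sum1_card expnS -mulnA mulnCA IHn; last first.
    by rewrite cardsDS // er cardD mulnS addKn.
  over.
have le_r : (r <= #|D|)%N by rewrite cardD mulnS leq_addr.
by rewrite card_draws_sum -cardD -(bin_fact le_r) cardD mulnS addKn.
Qed.


(** The division is exact by [card_uniform_partitions], so this counts the partitions of any set of
    [r * n] elements. *)
Definition num_uniform_partitions n := (r * n)`! %/ (r`! ^ n * n`!).

Local Notation c := num_uniform_partitions.

Lemma num_uniform_partitionsE D n : #|D| = (r * n)%N ->
  #|uniform_partitions D| = c n.
Proof.
move=> /card_uniform_partitions cardE.
by rewrite /c -cardE mulnK // muln_gt0 expn_gt0 !fact_gt0.
Qed.

Lemma sum_card_blocks_sub D A n : #|D| = (r * n.+1)%N -> A \subset D ->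
  \sum_(P in uniform_partitions D) #|P ::&: A| = 'C(#|A|, r) * c n.
Proof.
move=> cardD AD; have := sum_blocks_exchange (fun=> 1) AD.
under eq_bigr do rewrite muln1.
move=> ->; rewrite -card_draws_sum; apply: eq_bigr => e /andP[eA /eqP er].
rewrite sum1_card (@num_uniform_partitionsE _ n) //.
by rewrite cardsDS ?(subset_trans eA) // er cardD mulnS addKn.
Qed.

(** This is the first moment for [A = D], where all [n.+1] blocks are counted. It gives the
    probability [c n / c n.+1] that a fixed [r]-set is a block. *)
Lemma num_uniform_partitionsS D n : #|D| = (r * n.+1)%N ->
  c n.+1 * n.+1 = 'C(r * n.+1, r) * c n.
Proof.
move=> cardD; rewrite -cardD -(sum_card_blocks_sub cardD (subxx D)).
under eq_bigr => P PD do rewrite (card_blocks_sub_full cardD PD).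
by rewrite sum_nat_const (num_uniform_partitionsE cardD).
Qed.

(** Fix a block [e] inside [A], hence inside [B]. Pairing it with itself gives [c n.+1]; pairing it
    with another block in [B] gives the first moment for [B :\: e] in [D :\: e]. *)
Lemma sum_card_blocks_sub2 D A B n :
  #|D| = (r * n.+2)%N -> A \subset B -> B \subset D ->
  \sum_(P in uniform_partitions D) #|P ::&: A| * #|P ::&: B|
    = 'C(#|A|, r) * (c n.+1 + 'C(#|B| - r, r) * c n).
Proof.
move=> cardD AB BD; rewrite sum_blocks_exchange ?(subset_trans AB) //.
rewrite -card_draws_sum; apply: eq_bigr => e /andP[eA /eqP er].
have eB := subset_trans eA AB.
have cardDe : #|D :\: e| = (r * n.+1)%N.
  by rewrite cardsDS ?(subset_trans eB) // er cardD mulnS addKn.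
rewrite -(num_uniform_partitionsE cardDe) -er -(cardsDS eB) er.
rewrite -(sum_card_blocks_sub cardDe (setSD e BD)) -sum1_card -big_split /=.
apply: eq_bigr => Q QDe.
have disj_e f : f \in Q -> f :&: e = set0.
  move=> /(block_sub QDe); rewrite setDE subsetI => /andP[_].
  by rewrite -disjoints_subset -setI_eq0 => /eqP.
have eQ : e \notin Q.
  by apply/negP => /disj_e/eqP; rewrite setIid -cards_eq0 er eqn0Ngt r_gt0.
have -> : (e |: Q) ::&: B = e |: (Q ::&: (B :\: e)).
  apply/setP => f; rewrite !inE; have [->|_] := eqVneq f e; first by rewrite eB.
  have [fQ|//] := boolP (f \in Q).
  by rewrite setDE subsetI -disjoints_subset -setI_eq0 disj_e // eqxx andbT.
by rewrite cardsU1 inE negb_and eQ.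
Qed.

(* Distinct blocks of a random partition are negatively correlated, so only the
   diagonal pairs contribute to the covariance of the counts of blocks in A
   and B. *)
Lemma sum_card_blocks_sub2_le D A B n :
  #|D| = (r * n.+2)%N -> A \subset B -> B \subset D ->
  c n.+2 * (\sum_(P in uniform_partitions D) #|P ::&: A| * #|P ::&: B|)
    <= c n.+2 ^ 2 * n.+2
       + (\sum_(P in uniform_partitions D) #|P ::&: A|)
         * (\sum_(P in uniform_partitions D) #|P ::&: B|).
Proof.
move=> cardD AB BD; have AD := subset_trans AB BD.
rewrite (sum_card_blocks_sub2 cardD) // !(sum_card_blocks_sub cardD) //.
have leBD := subset_leq_card BD; rewrite cardD in leBD.
have leAD := subset_leq_card AD; rewrite cardD in leAD.
have cS2 := num_uniform_partitionsS cardD.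
(* Removing some [r]-set from [D] provides a ground set for the recurrence one level down. *)
have [e eD er] : exists2 e : {set T}, e \subset D & #|e| = r.
  have : 0 < #|[set A : {set T} | A \subset D & #|A| == r]|.
    by rewrite cards_draws bin_gt0 cardD mulnS leq_addr.
  by case/card_gt0P => e; rewrite inE => /andP[? /eqP ?]; exists e.
have cardDe : #|D :\: e| = (r * n.+1)%N.
  by rewrite cardsDS // er cardD mulnS addKn.
have cS1 := num_uniform_partitionsS cardDe.
rewrite mulnDr mulnDr leq_add //.
  rewrite expnS expn1 -mulnA leq_mul2l cS2 leq_mul2r leq_bin2l // !orbT //.
have := bin_subn_mul_le r leBD.
have -> : (r * n.+2 - r = r * n.+1)%N by rewrite mulnS addKn.
have : 0 < 'C(r * n.+1, r) by rewrite bin_gt0 mulnS leq_addr.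
move: cS1 cS2; move: ('C(_ - r, r)) ('C(#|B|, r)) => b' b.
move: ('C(r * n.+2, r)) ('C(r * n.+1, r)) => N' N.
move: (c n) (c n.+1) (c n.+2) ('C(#|A|, r)) => u v w x.
move=> cS1 cS2 N_gt0 le_b.
suff le_wuv : w * (b' * u) <= v * (b * v).
  by rewrite [leqLHS]mulnCA -[leqRHS]mulnA leq_mul2l le_wuv orbT.
(* With the factor [n.+2 * N], the recurrences eliminate [w] and [u] in favour of [v]; what remains
   is [le_b] together with [n.+1 <= n.+2]. *)
rewrite -(@leq_pmul2r (n.+2 * N)) ?muln_gt0 //.
have -> : w * (b' * u) * (n.+2 * N) = w * n.+2 * (N * u) * b' by ring.
rewrite cS2 -cS1.
have -> : N' * v * (v * n.+1) * b' = v * v * (b' * N' * n.+1) by ring.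
have -> : v * (b * v) * (n.+2 * N) = v * v * (b * N * n.+2) by ring.
by rewrite leq_mul2l leq_mul ?orbT.
Qed.

End UniformPartitions.

(** * Matchings and their edges inside prefixes *)

Section MatchingCounts.

Variables r n : nat.
Hypothesis r_gt0 : (0 < r)%N.
Implicit Types (M : {set {set 'I_(r * n)}}) (k : nat).

Local Notation prefix k := (prefix_set r n k).

Lemma matchings_uniform_partitions :
  matchings r n = uniform_partitions r [set: 'I_(r * n)].
Proof.
have cardT : #|[set: 'I_(r * n)]| = (r * n)%N by rewrite cardsT card_ord.
apply/setP => M; rewrite !inE.
have [partM /=|//] := boolP (partition M [set: 'I_(r * n)]).
have [unifM|] := boolP [forall e in M, #|e| == r]; last by rewrite andbF.
by rewrite (@card_blocks _ r r_gt0 setT M n) ?eqxx // inE partM.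
Qed.

Lemma card_matchings_gt0 : 0 < #|matchings r n|.
Proof.
have cardT : #|[set: 'I_(r * n)]| = (r * n)%N by rewrite cardsT card_ord.
rewrite matchings_uniform_partitions.
have := fact_gt0 (r * n); rewrite -(card_uniform_partitions r_gt0 cardT).
by rewrite muln_gt0 => /andP[].
Qed.

Lemma card_prefix_set k : k <= r * n -> #|prefix k| = k.
Proof.
move=> le_k; rewrite -sum1_card (eq_bigl (fun i : 'I_(r * n) => i < k)).
  by rewrite -(big_ord_widen _ (fun=> 1%N) le_k) sum1_card card_ord.
by move=> i; rewrite inE.
Qed.

Lemma prefix_set_sub k l : k <= l -> prefix k \subset prefix l.
Proof. by move=> kl; apply/subsetP => i; rewrite !inE => /leq_trans; apply. Qed.

Lemma crossing_weight_addn M k : M \in matchings r n -> k <= r * n ->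
  crossing_weight M k + r * #|M ::&: prefix k| = k.
Proof.
rewrite matchings_uniform_partitions => /uniform_partitionsP[partM cardM] le_k.
rewrite -[RHS](card_prefix_set le_k) -[in RHS]sum1_card.
rewrite (eq_bigl (fun i => (i \in [set: 'I_(r * n)]) && (i \in prefix k)));
  last by move=> i; rewrite in_setT.
rewrite (set_partition_big_cond _ partM) /=.
rewrite /crossing_weight -sum1_card big_distrr /=.
rewrite !(big_mkcond (fun e => e \in _ ::&: _)).
rewrite (big_mkcond (fun e => e \in crossing_edges _ _)) -big_split /=.
rewrite [RHS]big_mkcond; apply: eq_bigr => e _; rewrite !inE.
have [eM /=|//] := boolP (e \in M).
rewrite muln1 (eq_bigl [in e :&: prefix k]);
  last by move=> i /=; rewrite in_setI.
(* An edge inside the prefix contributes its [r] points to the second term, a crossing edge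
   contributes to the first, and an edge missing the prefix contributes nothing. *)
rewrite sum1_card -setDE setD_eq0; have [eA|eA] := boolP (e \subset prefix k).
  by rewrite andbF (setIidPl eA) cardM.
by rewrite andbT addn0; case: eqVneq => [->|//]; rewrite cards0.
Qed.

(** This is the sum of the Y_k, the only random quantity in the mean crossing weight. *)
Definition prefix_blocks M : nat :=
  \sum_(1 <= k < (r * n).+1) #|M ::&: prefix k|.

End MatchingCounts.

(** The expectation of the sum of the Y_k, cleared of denominators. The factor [r.+1] turns the
    hockey-stick value ['C((r * n.+1).+1, r.+1)] into a multiple of ['C(r * n.+1, r)], to which the
    recurrence applies. *)
Lemma sum_prefix_blocks r n : 0 < r ->
  r.+1 * (\sum_(M in matchings r n.+1) prefix_blocks M)
    = (r * n.+1).+1 * n.+1 * #|matchings r n.+1|.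
Proof.
move=> r_gt0; have cardT : #|[set: 'I_(r * n.+1)]| = (r * n.+1)%N.
  by rewrite cardsT card_ord.
rewrite matchings_uniform_partitions // exchange_big /=.
under eq_big_nat => k /andP[_ le_k].
  rewrite (sum_card_blocks_sub r_gt0 cardT) ?subsetT // card_prefix_set //.
  over.
rewrite -big_distrl /= sum_bin_hockey_stick // mulnA -mul_bin_diag -mulnA /=.
rewrite -(num_uniform_partitionsS r_gt0 cardT).
by rewrite (num_uniform_partitionsE r_gt0 cardT) mulnAC -mulnA.
Qed.

(** The square expands into [(r * n.+2) ^ 2] pairs of prefixes, each with covariance at most
    [n.+2]. *)
Lemma sum_prefix_blocks_sqr r n : 0 < r ->
  #|matchings r n.+2| * (\sum_(M in matchings r n.+2) prefix_blocks M ^ 2)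
    <= #|matchings r n.+2| ^ 2 * n.+2 * (r * n.+2) ^ 2
       + (\sum_(M in matchings r n.+2) prefix_blocks M) ^ 2.
Proof.
move=> r_gt0; have cardT : #|[set: 'I_(r * n.+2)]| = (r * n.+2)%N.
  by rewrite cardsT card_ord.
pose w := #|matchings r n.+2|; pose N := (r * n.+2)%N.
pose Y k (M : {set {set 'I_N}}) := #|M ::&: prefix_set r n.+2 k|.
have cov_le k l : w * (\sum_(M in matchings r n.+2) Y k M * Y l M)
    <= w ^ 2 * n.+2 + (\sum_(M in matchings r n.+2) Y k M)
                      * (\sum_(M in matchings r n.+2) Y l M).
  (* The covariance bound needs nested sets; the claim is symmetric in [k] and [l]. *)
  wlog le_kl : k l / k <= l.
    move=> le_w; have [/le_w//|/ltnW/le_w] := leqP k l.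
    by rewrite [X in _ <= _ + X]mulnC; under eq_bigr do rewrite mulnC.
  rewrite /w matchings_uniform_partitions //.
  rewrite (num_uniform_partitionsE r_gt0 cardT).
  by apply: sum_card_blocks_sub2_le => //; rewrite ?subsetT ?prefix_set_sub.
have sumZ : \sum_(M in matchings r n.+2) prefix_blocks M
    = \sum_(1 <= k < N.+1) \sum_(M in matchings r n.+2) Y k M.
  by rewrite exchange_big.
have sumZ2 : \sum_(M in matchings r n.+2) prefix_blocks M ^ 2
    = \sum_(1 <= k < N.+1) \sum_(1 <= l < N.+1)
        \sum_(M in matchings r n.+2) Y k M * Y l M.
  under [RHS]eq_bigr do rewrite exchange_big /=.
  rewrite [RHS]exchange_big /=; apply: eq_bigr => M _.
  by rewrite expnS expn1 big_distrlr.
rewrite sumZ2 sumZ -/w -/N -!mulnn big_distrlr big_distrr /=.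
have -> : w * w * n.+2 * (N * N)
    = \sum_(1 <= k < N.+1) \sum_(1 <= l < N.+1) w * w * n.+2.
  by rewrite !sum_nat_const_nat subn1 /=; ring.
rewrite -big_split /=; apply: leq_sum => k _.
by rewrite -big_split big_distrr /=; apply: leq_sum => l _.
Qed.

(** * Moments of the mean crossing weight and Chebyshev's inequality *)

Import Order.TTheory GRing.Theory Num.Theory.

Local Open Scope ring_scope.

Lemma mean_crossing_weightE (R : realFieldType) (r n : nat)
    (M : {set {set 'I_(r * n)}}) :
  (0 < r)%N -> (0 < n)%N -> M \in matchings r n ->
  mean_crossing_weight R M
    = ((r * n).+1)%:R / 2 - (prefix_blocks M)%:R / n%:R.
Proof.
move=> r_gt0 n_gt0 MO.
have r0 : r%:R != 0 :> R by rewrite pnatr_eq0 -lt0n.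
have n0 : n%:R != 0 :> R by rewrite pnatr_eq0 -lt0n.
have sumE : ((\sum_(1 <= k < (r * n).+1) crossing_weight M k
    + r * prefix_blocks M) * 2 = r * n * (r * n).+1)%N.
  rewrite /prefix_blocks big_distrr -big_split /=.
  under eq_big_nat => k /andP[_ le_k] do rewrite crossing_weight_addn //.
  elim: (r * n)%N => [|N IHN]; first by rewrite big_geq.
  by rewrite big_nat_recr //= mulnDl IHN; lia.
rewrite /mean_crossing_weight -natr_sum.
move/(congr1 (fun m => m%:R : R)): sumE; rewrite !natrM natrD natrM.
set S := (\sum_(_ <= _ < _) _)%:R; set Z := (prefix_blocks M)%:R => sumE.
have -> : S = r%:R * n%:R * (r * n).+1%:R / 2 - r%:R * Z.
  by rewrite -sumE; field.
by field; rewrite n0 r0.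
Qed.

Lemma expectation_mean_crossing_weight (R : realFieldType) (r n : nat) :
  (0 < r)%N -> (0 < n)%N ->
  finset_uniform_expectation (matchings r n) (fun M => mean_crossing_weight R M)
    = ((r%:R - 1) * (r%:R * n%:R + 1)) / (2 * (r%:R + 1)).
Proof.
case: n => // n r_gt0 _; rewrite /finset_uniform_expectation.
have w0 : #|matchings r n.+1|%:R != 0 :> R.
  by rewrite pnatr_eq0 -lt0n card_matchings_gt0.
under eq_bigr => M MO do rewrite mean_crossing_weightE //.
rewrite big_split /= sumr_const -mulr_natl sumrN -mulr_suml -natr_sum.
have := sum_prefix_blocks n r_gt0.
move/(congr1 (fun m => m%:R : R)); rewrite !natrM.
set Z := (\sum_(_ in _) _)%:R => ZE.
have r1 : r.+1%:R != 0 :> R by rewrite pnatr_eq0.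
have -> : Z = (r * n.+1).+1%:R * n.+1%:R * #|matchings r n.+1|%:R / r.+1%:R.
  by rewrite -ZE mulrC mulKf.
have n0 : n.+1%:R != 0 :> R by rewrite pnatr_eq0.
move: r1 n0; rewrite -[(r * n.+1).+1]addn1 -[r.+1]addn1 !natrD !natrM => r1.
move: w0; move: (n.+1%:R : R) => N w0 N0.
by field; rewrite r1 N0.
Qed.

(** The centre differs from the expectation by a constant [d], so the mean square is the variance
    plus [d ^+ 2]. Each of the two is at most [r%:R ^+ 2 * n%:R], whence the factor 2. *)
Lemma sum_mean_crossing_weight_sqr_le (R : realFieldType) (r n : nat) :
  (0 < r)%N -> (1 < n)%N ->
  \sum_(M in matchings r n) (mean_crossing_weight R M
      - (r%:R - 1) * (r%:R * n%:R) / (2 * (r%:R + 1))) ^+ 2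
    <= #|matchings r n|%:R * (2 * r%:R ^+ 2 * n%:R).
Proof.
case: n => [//|[//|n]] r_gt0 _.
set N : R := n.+2%:R; set w : R := #|matchings r n.+2|%:R.
have N_gt0 : 0 < N by rewrite ltr0n.
have w_gt0 : 0 < w by rewrite ltr0n card_matchings_gt0.
have r_ge1 : 1 <= r%:R :> R by rewrite ler1n.
have N_ge1 : 1 <= N by rewrite ler1n.
pose Z (M : {set {set 'I_(r * n.+2)}}) : R := (prefix_blocks M)%:R.
(* [mu] is the expectation of [Z], and [d] is the expected mean crossing weight minus the centre. *)
pose mu : R := (r%:R * N + 1) * N / (r%:R + 1).
pose d : R := (r%:R - 1) / (2 * (r%:R + 1)).
have r1_gt0 : 0 < r%:R + 1 :> R by rewrite ltr_pwDr.
have r1_neq0 := lt0r_neq0 r1_gt0; have N_neq0 := lt0r_neq0 N_gt0.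
have sumZ : \sum_(M in matchings r n.+2) Z M = mu * w.
  rewrite -natr_sum; apply: (mulfI r1_neq0).
  have := congr1 (fun m => m%:R : R) (sum_prefix_blocks n.+1 r_gt0).
  rewrite !natrM -[(r * n.+2).+1]addn1 -[r.+1]addn1 !natrD natrM => ->.
  by rewrite /mu /w /N; field.
have sumZ2 : \sum_(M in matchings r n.+2) Z M ^+ 2
    <= w * N * (r%:R * N) ^+ 2 + mu ^+ 2 * w.
  rewrite -(ler_pM2l w_gt0).
  have := sum_prefix_blocks_sqr n r_gt0.
  rewrite -(ler_nat R) natrD !natrM !natr_sum.
  under [X in _ * X <= _]eq_bigr do rewrite natrX.
  rewrite -/w -/N sumZ => /le_trans; apply.
  by rewrite le_eqVlt; apply/orP; left; apply/eqP; ring.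
have d_sqr : d ^+ 2 <= r%:R ^+ 2 * N.
  have d_ge0 : 0 <= d by rewrite divr_ge0 ?subr_ge0 // mulr_ge0 // ltW.
  have d_le1 : d <= 1 by rewrite ler_pdivrMr ?mulr_gt0 // mul1r; lra.
  have : 1 <= r%:R ^+ 2 :> R by rewrite exprn_ege1.
  by nra.
(* The deviation is [d + mu / N - Z M / N]; its square is ordered by powers of [Z M] so that the two
   moments can be inserted. *)
have devE M : M \in matchings r n.+2 ->
    (mean_crossing_weight R M
      - (r%:R - 1) * (r%:R * N) / (2 * (r%:R + 1))) ^+ 2
    = ((d + mu / N) ^+ 2 - 2 * (d + mu / N) / N * Z M) + N ^- 2 * Z M ^+ 2.
  move=> MO; rewrite mean_crossing_weightE // -/(Z M) -/N -[_.+1]addn1.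
  rewrite natrD natrM.
  rewrite -/N /d /mu; move: (Z M) (N) N_neq0 => z N' N'_neq0.
  by field; rewrite r1_neq0 N'_neq0.
under eq_bigr => M MO do rewrite devE //.
rewrite !big_split /= sumr_const -[_ *+ _]mulr_natl -/w sumrN -!mulr_sumr sumZ.
have : N ^- 2 * \sum_(M in matchings r n.+2) Z M ^+ 2
    <= N ^- 2 * (w * N * (r%:R * N) ^+ 2 + mu ^+ 2 * w).
  by rewrite ler_wpM2l // invr_ge0 exprn_ge0 ?ltW.
move=> le_sum; apply: le_trans (lerD (lexx _) le_sum) _.
have -> : w * (d + mu / N) ^+ 2 - 2 * (d + mu / N) / N * (mu * w)
    + N ^- 2 * (w * N * (r%:R * N) ^+ 2 + mu ^+ 2 * w)
    = w * (d ^+ 2 + r%:R ^+ 2 * N).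
  by move: (w) (d) (mu) (N) N_neq0 => w' d' mu' N' N'_neq0; field.
by rewrite ler_pM2l //; lra.
Qed.

(** Chebyshev's inequality about an arbitrary centre [c], with [V] a bound on the mean square
    deviation from [c]. *)
Lemma chebyshev_finset_uniform_prob (R : realFieldType) (T : finType)
    (Omega : {set T}) (X : T -> R) (c t V : R) :
  (0 < #|Omega|)%N -> 0 < t ->
  \sum_(x in Omega) (X x - c) ^+ 2 <= #|Omega|%:R * V ->
  1 - V / t ^+ 2
    <= finset_uniform_prob R Omega (fun x => `|X x - c| <= t) <= 1.
Proof.
move=> Omega_gt0 t_gt0 le_V; rewrite /finset_uniform_prob.
have w_gt0 : 0 < #|Omega|%:R :> R by rewrite ltr0n.
have t2_gt0 : 0 < t ^+ 2 by rewrite exprn_gt0.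
set G := [set x in Omega | _].
have sub_G : G \subset Omega by apply/subsetP => x; rewrite inE => /andP[].
rewrite ler_pdivrMr // mul1r ler_nat subset_leq_card // andbT ler_pdivlMr //.
suff : (#|Omega|%:R - #|G|%:R) * t ^+ 2 <= #|Omega|%:R * V.
  by rewrite -(ler_pdivlMr _ _ t2_gt0) mulrBl mul1r mulrAC (mulrC V); lra.
(* Each element of [Omega] outside [G] contributes at least [t ^+ 2] to the sum of squares. *)
apply: le_trans le_V; rewrite -natrB ?subset_leq_card // -cardsDS //.
rewrite -sum1_card natr_sum mulr_suml big_mkcond [leRHS]big_mkcond /=.
apply: ler_sum => x _; rewrite !inE; have [xO|//] := boolP (x \in Omega).
case: ifPn => [|_]; last exact: sqr_ge0.
rewrite andTb andbT -ltNge mul1r => /ltW lt_t.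
rewrite -[leRHS]real_normK ?num_real //.
by rewrite ler_sqr ?nnegrE ?(ltW t_gt0) ?normr_ge0.
Qed.

(* Passage to the limit *)
From mathcomp Require Import all_classical all_reals all_analysis.

Import numFieldNormedType.Exports.

Local Open Scope classical_set_scope.
Local Open Scope ring_scope.

Theorem theorem1p3 (R : realType) (r : nat) (hr : (2 <= r)%N) :
  (forall n : nat, (1 <= n)%N ->
     finset_uniform_expectation (matchings r n) (fun M => mean_crossing_weight R M)
       = ((r%:R - 1) * (r%:R * n%:R + 1)) / (2 * (r%:R + 1)))
  /\
  (forall omega : nat -> R,
     omega n @[n --> \oo] --> +oo ->
     finset_uniform_prob R (matchings r n)
       (fun M => `|mean_crossing_weight R M
                   - (r%:R - 1) * (r%:R * n%:R) / (2 * (r%:R + 1))|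
                 <= omega n * Num.sqrt n%:R)
       @[n --> \oo] --> (1 : R)).
Proof.
have r_gt0 : (0 < r)%N by apply: leq_trans hr.
split=> [n n_gt0|omega omega_oo]; first exact: expectation_mean_crossing_weight.
(* For [t = omega n * Num.sqrt n%:R] the factor [n%:R] of the second-moment bound cancels, leaving a
   Chebyshev error of [V / omega n ^+ 2]. *)
pose V : R := 2 * r%:R ^+ 2.
have omegaV : (omega n)^-1 @[n --> \oo] --> (0 : R).
  by apply/gtr0_cvgV0 => //; exact: (cvgryPgt _).1 omega_oo 0.
have lower : 1 - V * ((omega n)^-1 * (omega n)^-1) @[n --> \oo] --> (1 : R).
  have {2}<- : 1 - V * (0 * 0) = 1 :> R by rewrite !mulr0 subr0.
  by apply: cvgB; [|apply: cvgM; [|apply: cvgM]] => //; exact: cvg_cst.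
apply: (squeeze_cvgr _ lower (cvg_cst (1 : R))).
near=> n.
have omega_gt0 : 0 < omega n by near: n; exact: (cvgryPgt _).1 omega_oo 0.
have n_gt1 : (1 < n)%N by near: n; exact: nbhs_infty_gt.
have n_gt0 : 0 < n%:R :> R by rewrite ltr0n ltnW.
have sqrt_gt0 : 0 < Num.sqrt n%:R :> R by rewrite sqrtr_gt0.
have -> : V * ((omega n)^-1 * (omega n)^-1)
    = 2 * r%:R ^+ 2 * n%:R / (omega n * Num.sqrt n%:R) ^+ 2.
  rewrite exprMn sqr_sqrtr ?ltW // /V.
  move: (omega n) (n%:R : R) omega_gt0 n_gt0 => w m w_gt0 m_gt0.
  by field; rewrite !lt0r_neq0.
apply: chebyshev_finset_uniform_prob; first exact: card_matchings_gt0.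
  exact: mulr_gt0.
exact: sum_mean_crossing_weight_sqr_le.
Unshelve. all: by end_near.
Qed.
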